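(* Let $X$ and $Y$ be Banach spaces. An element $(a,b)$ belongs to $\mathrm{SCD}(B_{X\oplus_\infty Y})$ if and only if $a\in\mathrm{SCD}(B_X)$ and $b\in\mathrm{SCD}(B_Y)$.
   Context: Banach spaces are over $\mathbb{K}=\mathbb{R}$ or $\mathbb{C}$; $B_X$ and $X^*$ denote the closed unit ball and the topological dual of $X$. A slice of a bounded set $A\subseteq X$ is a non-empty intersection of $A$ with an open half-space; it can be written as $S(A,x^*,\alpha)=\{x\in A:\operatorname{Re}x^*(x)>\sup_{b\in A}\operatorname{Re}x^*(b)-\alpha\}$ with $x^*\in X^*$, $\alpha>0$. Let $A\subseteq X$ be bounded and convex and $a\in A$. A countable collection $\{V_n:n\in\mathbb{N}\}$ of non-empty subsets of $A$ is determining for $a$ if $a\in\overline{\mathrm{conv}}(B)$ whenever $B\subseteq A$ intersects all the sets $V_n$. The point $a$ is an SCD point (slicely countably determined point) of $A$ if there is a sequence of slices of $A$ that is determining for $a$; $\mathrm{SCD}(A)$ is the set of all SCD points of $A$. $X\oplus_\infty Y$ is the product space $X\times Y$ with norm $\|(x,y)\|_\infty=\max\{\|x\|,\|y\|\}$. *)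

(* Defs.v *)
From HB Require Import structures.
From mathcomp Require Import all_boot all_order all_algebra.
From mathcomp Require Import all_classical all_reals all_analysis.
From mathcomp Require Import complex.

Set Implicit Arguments.
Unset Strict Implicit.
Unset Printing Implicit Defensive.

Import Order.TTheory GRing.Theory Num.Theory.
Import numFieldNormedType.Exports.

Local Open Scope classical_set_scope.
Local Open Scope ring_scope.

(* [K] is the scalar field and [re : K -> R] its real part: the intended
   instances are [K = R] with [re = id], and [K = R[i]] with [re = complex.Re].
   In [R[i]] the order [x <= y] means that [y - x] is real and nonnegative, so
   norm inequalities and the weights [0 <= t <= 1] of convex combinations have
   their usual meaning over both fields. *)
Section SCD.
Context {R : realType} {K : numFieldType} (re : K -> R).

Definition unit_ball (X : normedModType K) : set X := [set x | `|x| <= 1].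

Definition convex_hull (X : normedModType K) (B : set X) : set X :=
  smallest (@convex_set K X) B.

(* [sup] is the true supremum when [A] is bounded and nonempty and [f] is
   continuous. *)
Definition slice (X : normedModType K) (A : set X) (f : X -> K) (alpha : R) :
    set X :=
  [set x | A x /\ sup [set re (f b) | b in A] - alpha < re (f x)].

(* [f] ranges over the whole dual, [f = 0] included; this matters only for
   [X = 0]. *)
Definition is_slice (X : normedModType K) (A S : set X) : Prop :=
  S !=set0 /\
  exists (f : {linear X -> K^o}) (alpha : R),
    [/\ continuous f, 0 < alpha & S = slice A f alpha].

Definition determining (X : normedModType K) (A : set X) (a : X)
    (V : nat -> set X) : Prop :=
  (forall n, V n `<=` A /\ V n !=set0) /\
  forall B : set X, B `<=` A -> (forall n, B `&` V n !=set0) ->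
    closure (convex_hull B) a.

Definition SCD (X : normedModType K) (A : set X) : set X :=
  [set a | A a /\ exists V : nat -> set X,
    (forall n, is_slice A (V n)) /\ determining A a V].

End SCD.

Arguments unit_ball {K} X.

(* Main.v *)
Require Import Defs.
From HB Require Import structures.
From mathcomp Require Import all_boot all_order all_algebra.
From mathcomp Require Import all_classical all_reals all_analysis.
From mathcomp Require Import complex lra.
Import Order.TTheory GRing.Theory Num.Theory.
Import numFieldNormedType.Exports.
Local Open Scope classical_set_scope.
Local Open Scope ring_scope.

(**
Everything rests on how slices of the unit ball of X * Y compare with products
of slices.  A functional h on X * Y is h (x, y) = f x + g y, and the unit ball
is the product of the two unit balls, so the supremum of Re h on it is the sum
of the suprema of Re f and Re g.  Hence a point at which Re h is within r of
its supremum has each coordinate within r of its own supremum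
([slice_in_prod]), and a pair of coordinates each within r / 2 is a point
within r ([prod_in_slice]).

If (a, b) is an SCD point with slices W n, pick slices S n and T n with
S n `*` T n inside W n.  As T n is nonempty, S n lies in the projection of
W n; so if B meets every S n, then the cylinder over B meets every W n,
(a, b) is in the closed convex hull of the cylinder, and projecting puts a in
that of B ([SCD_image], which also serves for b).

Conversely, let S n and T m be determining for a and b, and pick slices W n m
inside S n `*` T m.  Let B meet all of them, with convex hull C.  For a fixed
n, the second coordinates of the points of C lying over S n form a convex set
that meets every T m, hence comes arbitrarily close to b.  So for each e the
first coordinates of the points of C whose second coordinate is e-close to b
form a convex set that meets every S n, hence comes arbitrarily close to a.
Thus (a, b) is in the closure of C ([SCD_prod]).

The argument is the same over both scalar fields, using only a few properties
of the real part, collected in [real_part].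
*)

(** * Convex sets *)

(** Replaces the membership test and the bundled weights of the definition by
plain propositions. *)
Lemma convex_setP (K : numFieldType) (X : normedModType K) (A : set X) :
  @convex_set K X A <->
  (forall (x y : X) (t : K), 0 <= t -> t <= 1 -> A x -> A y ->
     A (t *: x + (1 - t) *: y)).
Proof.
split=> [cA x y t t0 t1 Ax Ay|cA x y t].
  have tI : (0 <= t <= 1) by rewrite t0.
  have := cA x y (Itv01 t0 t1); rewrite !inE; exact.
by rewrite !inE => Ax Ay; apply: cA.
Qed.

Lemma convex_set_preimage (K : numFieldType) (X Y : normedModType K)
    (f : {linear X -> Y}) (A : set Y) :
  @convex_set K Y A -> @convex_set K X (f @^-1` A).
Proof.
move=> /convex_setP cA; apply/convex_setP => x y t t0 t1 Ax Ay /=.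
by rewrite linearD !linearZ; exact: cA.
Qed.

Lemma convex_set_image (K : numFieldType) (X Y : normedModType K)
    (f : {linear X -> Y}) (A : set X) :
  @convex_set K X A -> @convex_set K Y (f @` A).
Proof.
move=> /convex_setP cA; apply/convex_setP => _ _ t t0 t1 [x Ax <-] [y Ay <-].
by exists (t *: x + (1 - t) *: y); [exact: cA|rewrite linearD !linearZ].
Qed.

Lemma convex_setI (K : numFieldType) (X : normedModType K) (A B : set X) :
  @convex_set K X A -> @convex_set K X B -> @convex_set K X (A `&` B).
Proof.
move=> /convex_setP cA /convex_setP cB; apply/convex_setP.
by move=> x y t t0 t1 [Ax Bx] [Ay By]; split; [exact: cA|exact: cB].
Qed.

Lemma convex_closed_ball_ (K : numFieldType) (X : normedModType K) (c : X)
    (r : K) : @convex_set K X [set x | `|c - x| <= r].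
Proof.
apply/convex_setP => x y t t0 t1 /= xr yr.
have s0 : 0 <= 1 - t by rewrite subr_ge0.
have -> : c - (t *: x + (1 - t) *: y) = t *: (c - x) + (1 - t) *: (c - y).
  rewrite !scalerBr addrACA -scalerDl [t + _]addrC subrK scale1r.
  by rewrite opprD.
have -> : r = t * r + (1 - t) * r by rewrite -mulrDl [t + _]addrC subrK mul1r.
apply: le_trans (ler_normD _ _) _; rewrite !normrZ ger0_norm // (ger0_norm s0).
by apply: lerD; exact: ler_wpM2l.
Qed.

Lemma convex_unit_ball (K : numFieldType) (X : normedModType K) :
  @convex_set K X (unit_ball X).
Proof.
have -> : unit_ball X = [set x | `|0 - x| <= 1]; last exact: convex_closed_ball_.
by apply/funext => x /=; rewrite sub0r normrN.
Qed.

Lemma convex_convex_hull (K : numFieldType) (X : normedModType K) (B : set X) :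
  @convex_set K X (convex_hull B).
Proof.
apply/convex_setP => x y t t0 t1 Bx By C [cC BC].
by move/convex_setP: (cC); apply => //; [exact: Bx|exact: By].
Qed.

(** * Slices of the unit ball *)

(** What makes [re] behave as a real part: real-linearity, in the form needed
for nonnegative weights, and the bound by the norm that makes continuous
functionals have bounded real part on the ball. *)
Record real_part {R : realType} {K : numFieldType} (re : K -> R) := RealPart {
  re1 : re 1 = 1 ;
  reD : forall z w, re (z + w) = re z + re w ;
  reM : forall t z, 0 <= t -> re (t * z) = re t * re z ;
  re_ge0 : forall t, 0 <= t -> 0 <= re t ;
  re_le_norm : forall z, re z <= re `|z| }.

Arguments re1 {R K re}.
Arguments reD {R K re}.
Arguments reM {R K re}.
Arguments re_ge0 {R K re}.
Arguments re_le_norm {R K re}.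

Section Slices.
Context {R : realType} {K : numFieldType} {re : K -> R} (reP : real_part re).

Lemma le_re z w : z <= w -> re z <= re w.
Proof.
move=> zw; rewrite -[w](subrK z) (reD reP) lerDr.
by rewrite (re_ge0 reP) // subr_ge0.
Qed.

Context {X : normedModType K}.

Lemma has_sup_unit_ball {f : {linear X -> K^o}} :
  continuous f -> has_sup [set re (f x) | x in unit_ball X].
Proof.
move=> cf; split.
  by exists (re (f 0)), 0 => //; rewrite /unit_ball /= normr0.
have /linear_boundedP [M [Mr fM]] := continuous_linear_bounded (0 : X) (cf 0).
have M0 : 0 <= `|M| + 1 by rewrite addr_ge0.
exists (re (`|M| + 1)) => _ [x x1 <-].
apply: le_trans (re_le_norm reP _) _; apply: le_re.
apply: le_trans (fM (`|M| + 1) _ x) _.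
  by rewrite (le_lt_trans (real_ler_norm Mr)) // ltrDl.
by rewrite -[leRHS]mulr1; exact: ler_wpM2l.
Qed.

Lemma slice_is_slice (f : {linear X -> K^o}) (alpha : R) :
  continuous f -> 0 < alpha ->
  is_slice re (unit_ball X) (slice re (unit_ball X) f alpha).
Proof.
move=> cf a0; split; last by exists f, alpha.
have [_ [x Ax <-] lx] := sup_adherent a0 (has_sup_unit_ball cf).
by exists x; split.
Qed.

Lemma is_slice_sub {A S : set X} :
  is_slice re A S -> S `<=` A /\ S !=set0.
Proof. by move=> [S0 [f [alpha [_ _ SE]]]]; split=> //; rewrite SE => x []. Qed.

(** The real part of a convex combination is the convex combination of the
real parts, so strict lower bounds on [re \o f] are preserved. *)
Lemma convex_slice (A S : set X) :
  @convex_set K X A -> is_slice re A S -> @convex_set K X S.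
Proof.
move=> /convex_setP cA [_ [f [alpha [_ _ ->]]]].
apply/convex_setP => x y t t0 t1 [Ax fx] [Ay fy]; split; first exact: cA.
rewrite linearD !linearZ /= (reD reP) !(reM reP) ?subr_ge0 //.
set c := sup _ - _ in fx fy *.
have rt0 : 0 <= re t by exact: re_ge0 reP _ t0.
have rs : re (1 - t) = 1 - re t.
  by have := reD reP (1 - t) t; rewrite subrK (re1 reP) => ->; rewrite addrK.
have rs0 : 0 <= 1 - re t by rewrite -rs (re_ge0 reP) // subr_ge0.
rewrite rs; set u := re (f x) in fx *; set v := re (f y) in fy *.
have [->|rtN0] := eqVneq (re t) 0; first by lra.
have : 0 < re t * (u - c) by rewrite mulr_gt0 ?subr_gt0 // lt_def rtN0.
have : 0 <= (1 - re t) * (v - c) by rewrite mulr_ge0 // subr_ge0 ltW.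
lra.
Qed.

End Slices.

(** * Slices of the unit ball of a product *)

Lemma unit_ball_prod {K : numFieldType} {X Y : normedModType K} :
  unit_ball (X * Y)%type = unit_ball X `*` unit_ball Y.
Proof.
apply/funext => -[x y]; apply/propext.
rewrite /unit_ball /= prod_normE /= comparable_ge_max ?real_comparable //.
by split=> [/andP|[-> ->]].
Qed.

Section Prod.
Context {R : realType} {K : numFieldType} {re : K -> R} (reP : real_part re).
Context {X Y : normedModType K}.

Definition in1 (x : X) : (X * Y)%type := (x, 0).
Definition in2 (y : Y) : (X * Y)%type := (0, y).

Lemma in1_is_linear : linear in1.
Proof. by move=> t x y; rewrite /in1; congr pair; rewrite /= scaler0 addr0. Qed.

Lemma in2_is_linear : linear in2.
Proof. by move=> t x y; rewrite /in2; congr pair; rewrite /= scaler0 addr0. Qed.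

HB.instance Definition _ := GRing.isLinear.Build K X (X * Y)%type _
  in1 in1_is_linear.
HB.instance Definition _ := GRing.isLinear.Build K Y (X * Y)%type _
  in2 in2_is_linear.

Lemma continuous_in1 : continuous in1.
Proof. by move=> x; apply: cvg_pair; [exact: cvg_id|exact: cvg_cst]. Qed.

Lemma continuous_in2 : continuous in2.
Proof. by move=> x; apply: cvg_pair; [exact: cvg_cst|exact: cvg_id]. Qed.

(** The dual norm of the max norm is the sum of the dual norms: the coordinates
of a point of the product ball vary independently. *)
Lemma sup_unit_ball_prod (h : {linear (X * Y)%type -> K^o})
    (f : {linear X -> K^o}) (g : {linear Y -> K^o}) :
  (forall p, h p = f p.1 + g p.2) -> continuous f -> continuous g ->
  sup [set re (h p) | p in unit_ball (X * Y)%type] =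
  sup [set re (f x) | x in unit_ball X] + sup [set re (g y) | y in unit_ball Y].
Proof.
move=> hE cf cg; rewrite -sup_sumE; [|exact: has_sup_unit_ball..].
congr sup; apply/seteqP; rewrite unit_ball_prod; split.
  move=> _ [[x y] [/= x1 y1] <-]; exists (re (f x)); first by exists x.
  by exists (re (g y)); [exists y|rewrite hE (reD reP)].
move=> _ [_ [x x1 <-]] [_ [y y1 <-] <-].
by exists (x, y) => //; rewrite hE (reD reP).
Qed.

(** A near-maximizer of [f x + g y] nearly maximizes each term, since neither
term can exceed its own supremum to compensate for the other. *)
Lemma slice_in_prod (S : set X) (T : set Y) :
  is_slice re (unit_ball X) S -> is_slice re (unit_ball Y) T ->
  exists W, is_slice re (unit_ball (X * Y)%type) W /\ W `<=` S `*` T.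
Proof.
move=> [_ [f [r [cf r0 ->]]]] [_ [g [s [cg s0 ->]]]].
pose h : {linear (X * Y)%type -> K^o} := (f \o fst) \+ (g \o snd).
have ch : continuous h.
  move=> p; apply: (@continuousD _ _ _ (f \o fst) (g \o snd)).
    by apply: continuous_comp; [exact: cvg_fst|exact: cf].
  by apply: continuous_comp; [exact: cvg_snd|exact: cg].
exists (slice re (unit_ball (X * Y)%type) h (Num.min r s)); split.
  by apply: slice_is_slice; rewrite ?lt_min ?r0.
move=> [x y] [xy]; rewrite (sup_unit_ball_prod h f g) //.
rewrite unit_ball_prod in xy; case: xy => /= x1 y1.
rewrite (reD reP) => hxy.
have fx : re (f x) <= sup [set re (f x) | x in unit_ball X].
  by apply: ub_le_sup; [exact: (has_sup_unit_ball reP cf).2|exists x].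
have gy : re (g y) <= sup [set re (g y) | y in unit_ball Y].
  by apply: ub_le_sup; [exact: (has_sup_unit_ball reP cg).2|exists y].
have mr : Num.min r s <= r by rewrite ge_min lexx.
have ms : Num.min r s <= s by rewrite ge_min lexx orbT.
split; split => //=; lra.
Qed.

(** The allowed defect is shared equally between the two coordinates of the
functional. *)
Lemma prod_in_slice (W : set (X * Y)%type) :
  is_slice re (unit_ball (X * Y)%type) W ->
  exists S T, [/\ is_slice re (unit_ball X) S, is_slice re (unit_ball Y) T &
    S `*` T `<=` W].
Proof.
move=> [_ [h [r [ch r0 ->]]]].
pose f : {linear X -> K^o} := h \o in1; pose g : {linear Y -> K^o} := h \o in2.
have cf : continuous f.
  by move=> x; apply: continuous_comp; [exact: continuous_in1|exact: ch].
have cg : continuous g.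
  by move=> x; apply: continuous_comp; [exact: continuous_in2|exact: ch].
have hE p : h p = f p.1 + g p.2.
  case: p => x y; rewrite /f /g /= -linearD; congr (h _).
  by rewrite /in1 /in2; congr pair; rewrite /= ?addr0 ?add0r.
have r2 : 0 < r / 2 by lra.
exists (slice re (unit_ball X) f (r / 2)), (slice re (unit_ball Y) g (r / 2)).
split; try exact: slice_is_slice.
move=> [x y] [/= [x1 fx] [y1 gy]]; split; first by rewrite unit_ball_prod.
by rewrite (sup_unit_ball_prod h f g) // hE (reD reP) /=; lra.
Qed.

(** * SCD points of the unit ball of a product *)

(** The slices are indexed by pairs, one for each slice of X and each slice of
Y.  This lets the approximation of b be carried out inside every single slice
[S n], before a is approximated. *)
Lemma SCD_prod (a : X) (b : Y) :
  SCD re (unit_ball X) a -> SCD re (unit_ball Y) b ->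
  SCD re (unit_ball (X * Y)%type) (a, b).
Proof.
move=> [a1 [S [Ssl [_ Sdet]]]] [b1 [T [Tsl [_ Tdet]]]].
split; first by rewrite unit_ball_prod.
have /choice [W WP] : forall nm : nat * nat, exists W,
    is_slice re (unit_ball (X * Y)%type) W /\ W `<=` S nm.1 `*` T nm.2.
  by move=> nm; exact: slice_in_prod.
(* [unpickle] enumerates the pairs; the default value only repeats a slice. *)
pose V k := W (odflt (0, 0)%N (unpickle k)).
have Vsl k : is_slice re (unit_ball (X * Y)%type) (V k) by exact: (WP _).1.
exists V; split => //; split.
  by move=> k; exact: is_slice_sub.
move=> B B1 BV; pose C := convex_hull B.
have cC : convex_set C by exact: convex_convex_hull.
have C1 : C `<=` unit_ball X `*` unit_ball Y.
  by rewrite -unit_ball_prod; apply: smallest_sub => //; exact: convex_unit_ball.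
have CST n m : exists x y, [/\ C (x, y), S n x & T m y].
  have [[x y] [Bxy]] := BV (pickle (n, m)).
  rewrite /V pickleK /= => /(WP (n, m)).2 [/= Snx Tmy].
  by exists x, y; split => //; exact: sub_gen_smallest.
move=> U /nbhs_ballP [e /= e0 abU].
pose e2 := e / 2.
have e20 : 0 < e2 by rewrite divr_gt0.
(* The radius is halved because [E] uses a closed ball around b. *)
pose E := fst @` (C `&` snd @^-1` [set y | `|b - y| <= e2]).
have cE : @convex_set K X E.
  apply: convex_set_image; apply: convex_setI => //.
  by apply: convex_set_preimage; exact: convex_closed_ball_.
have ES n : E `&` S n !=set0.
  pose D := snd @` (C `&` fst @^-1` S n).
  have cD : @convex_set K Y D.
    apply: convex_set_image; apply: convex_setI => //.
    apply: convex_set_preimage.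
    by apply: convex_slice (Ssl n) => //; exact: convex_unit_ball.
  have : closure (convex_hull D) b.
    apply: Tdet; first by move=> _ [p [/C1 [_ p1] _] <-].
    by move=> m; have [x [y [Cxy Snx Tmy]]] := CST n m; exists y; split => //;
      exists (x, y).
  move=> /(_ _ (nbhsx_ballx b e2 e20)) [y []].
  rewrite /convex_hull smallest_id // => -[[x z] /= [Cxz Snx] <-].
  rewrite -ball_normE /= => /ltW bz.
  by exists x; split => //; exists (x, z).
have : closure (convex_hull E) a.
  by apply: Sdet => // _ [p [/C1 [p1 _] _] <-].
move=> /(_ _ (nbhsx_ballx a e e0)) [x []].
rewrite /convex_hull smallest_id // => -[[z y] /= [Czy by2] <-] az.
exists (z, y); split => //; apply: abU; split => //=.
rewrite -ball_normE /=; apply: le_lt_trans by2 _.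
by rewrite /e2 ltr_pdivrMr // ltr_pMr // ltr1n.
Qed.

End Prod.

(** If every slice of A projects onto a superset of some slice of A', then a set
B meeting these slices of A' lifts to a set [A `&` f @^-1` B] meeting the given
slices of A; continuity and linearity bring the conclusion back along f. *)
Lemma SCD_image {R : realType} {K : numFieldType} {re : K -> R}
    {Z X : normedModType K} {f : {linear Z -> X}} {A : set Z} {A' : set X}
    {z : Z} :
  continuous f -> f @` A `<=` A' ->
  (forall W, is_slice re A W -> exists2 S, is_slice re A' S & S `<=` f @` W) ->
  SCD re A z -> SCD re A' (f z).
Proof.
move=> cf fA fsl [Az [W [Wsl [WA Wdet]]]].
split; first by apply: fA; exists z.
have /choice [S SP] : forall n, exists S, is_slice re A' S /\ S `<=` f @` W n.
  by move=> n; have [S ? ?] := fsl _ (Wsl n); exists S.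
have Ssl n := (SP n).1; exists S; split => //; split.
  by move=> n; exact: is_slice_sub.
move=> B BA' BS U Ufz.
have : closure (convex_hull (A `&` f @^-1` B)) z.
  apply: Wdet => [x []//|n].
  have [x [Bx /(SP n).2 [w Ww wx]]] := BS n.
  by exists w; split => //; split; [exact: (WA n).1|rewrite /= wx].
move=> /(_ _ (cf z U Ufz)) [w [Cw Ufw]]; exists (f w); split => //.
have : convex_hull (A `&` f @^-1` B) `<=` f @^-1` convex_hull B.
  apply: smallest_sub.
    by apply: convex_set_preimage; exact: convex_convex_hull.
  by move=> x [_ Bfx]; exact: sub_gen_smallest.
exact.
Qed.

Lemma SCD_unit_ball_prod (R : realType) (K : numFieldType) (re : K -> R)
    (X Y : normedModType K) (a : X) (b : Y) : real_part re ->
  SCD re (unit_ball (X * Y)%type) (a, b) <->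
  SCD re (unit_ball X) a /\ SCD re (unit_ball Y) b.
Proof.
move=> reP; split; last by case; exact: SCD_prod.
move=> Sab; split.
  apply: (SCD_image (f := fst) _ _ _ Sab); first by move=> p; exact: cvg_fst.
    by rewrite unit_ball_prod => _ [p [? ?] <-].
  move=> W /(prod_in_slice reP) [S [T [Ssl [[y Ty] _] STW]]].
  by exists S => // x Sx; exists (x, y) => //; exact: STW.
apply: (SCD_image (f := snd) _ _ _ Sab); first by move=> p; exact: cvg_snd.
  by rewrite unit_ball_prod => _ [p [? ?] <-].
move=> W /(prod_in_slice reP) [S [T [[[x Sx] _] Tsl STW]]].
by exists T => // y Ty; exists (x, y) => //; exact: STW.
Qed.

Lemma real_part_id (R : realType) : real_part (@id R).
Proof. by split => // x; exact: ler_norm. Qed.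

Lemma real_part_Re (R : realType) : real_part (@complex.Re R).
Proof.
split => //.
- by move=> [? ?] [? ?].
- move=> [t t'] [x y]; rewrite lecE /= => /andP [/eqP -> _].
  by rewrite mul0r subr0.
- by move=> t; rewrite lecE => /andP [].
- move=> z; have := normc_ge_Re z; rewrite lecE /= => /andP [_].
  exact/le_trans/ler_norm.
Qed.

Theorem proposition3p3 (R : realType) :
  (forall (X Y : completeNormedModType R) (a : X) (b : Y),
     SCD (@id R) (unit_ball (X * Y)%type) (a, b) <->
     SCD (@id R) (unit_ball X) a /\ SCD (@id R) (unit_ball Y) b) /\
  (forall (X Y : completeNormedModType R[i]) (a : X) (b : Y),
     SCD (@complex.Re R) (unit_ball (X * Y)%type) (a, b) <->
     SCD (@complex.Re R) (unit_ball X) a /\ SCD (@complex.Re R) (unit_ball Y) b).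
Proof.
split=> X Y a b.
  apply: SCD_unit_ball_prod; exact: (real_part_id R).
apply: SCD_unit_ball_prod; exact: (real_part_Re R).
Qed.
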